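(* Let $\alpha,\beta>-1$. Then, for any nonnegative integers $n$ and $m$ such that $n\neq m$, we have $$\int_x^1 P_n^{(\alpha,\beta)}(t)\,P_m^{(\alpha,\beta)}(t)\,w(t)\,dt=\frac{w(x)(1-x^2)\,\varphi_n(m;\alpha,\beta,x)}{n(n+\alpha+\beta+1)-m(m+\alpha+\beta+1)},$$ where $w(t)=(1-t)^{\alpha}(1+t)^{\beta}$ and $x$ is any real number.
   Context: For $\alpha,\beta>-1$ and a nonnegative integer $n$, the Jacobi polynomial $P_n^{(\alpha,\beta)}$ is the polynomial solution of the Jacobi differential equation $$(1-x^2)\frac{d^2y}{dx^2}+(\beta-\alpha-(\alpha+\beta+2)x)\frac{dy}{dx}+n(n+\alpha+\beta+1)y=0$$ given by $$P_n^{(\alpha,\beta)}(x)=\frac{(\alpha+1)_n}{n!}\sum_{k=0}^{n}\frac{(-n)_k(\alpha+\beta+n+1)_k}{(\alpha+1)_k\,k!}\left(\frac{1-x}{2}\right)^k,$$ where $(a)_k$ is the Pochhammer symbol, that is, $(a)_0=1$ and $(a)_k=a(a+1)\cdots(a+k-1)$ for $k=1,2,3,\dots$. The augmented Wronskian $\varphi_n(m;\alpha,\beta,x)$ is the determinant $$\varphi_n(m;\alpha,\beta,x)=\begin{vmatrix}P_m^{(\alpha,\beta)}(x)&P_n^{(\alpha,\beta)}(x)\\ \dfrac{dP_m^{(\alpha,\beta)}(x)}{dx}&\dfrac{dP_n^{(\alpha,\beta)}(x)}{dx}\end{vmatrix}=P_m^{(\alpha,\beta)}(x)\,\frac{dP_n^{(\alpha,\beta)}(x)}{dx}-P_n^{(\alpha,\beta)}(x)\,\frac{dP_m^{(\alpha,\beta)}(x)}{dx}.$$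 *)

(* Defs.v *)
From HB Require Import structures.
From mathcomp Require Import all_boot all_order all_algebra.
From mathcomp Require Import complex.
From mathcomp Require Import all_classical all_reals all_analysis.
Import Order.TTheory GRing.Theory Num.Theory.
Import numFieldNormedType.Exports.

Set Implicit Arguments.
Unset Strict Implicit.
Unset Printing Implicit Defensive.

Local Open Scope classical_set_scope.
Local Open Scope ring_scope.
Local Open Scope complex_scope.

Definition pochhammer (R : pzRingType) (a : R) (k : nat) : R :=
  \prod_(i < k) (a + i%:R).

Definition jacobi (R : fieldType) (alpha beta : R) (n : nat) : {poly R} :=
  (pochhammer (alpha + 1) n / n`!%:R) *:
    \sum_(k < n.+1)
      (pochhammer (- n%:R) k * pochhammer (alpha + beta + n%:R + 1) k
         / (pochhammer (alpha + 1) k * k`!%:R)) *: (2^-1 *: (1 - 'X)) ^+ k.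

(* The rows are the derivatives of order 0 and 1; the columns are P_m, P_n. *)
Definition augmented_wronskian (R : fieldType) (alpha beta : R) (n m : nat) :
    {poly R} :=
  \det (\matrix_(i < 2, j < 2)
          (if j == 0 then jacobi alpha beta m else jacobi alpha beta n)^`(i)).

Lemma augmented_wronskianE (R : fieldType) (alpha beta : R) (n m : nat) :
  augmented_wronskian alpha beta n m =
  jacobi alpha beta m * (jacobi alpha beta n)^`()
  - jacobi alpha beta n * (jacobi alpha beta m)^`().
Proof.
rewrite /augmented_wronskian (expand_det_row _ ord0) !big_ord_recl big_ord0.
by rewrite /cofactor !det_mx11 !mxE /= addr0 expr0 expr1 mul1r mulN1r mulrN.
Qed.

(* Real power of a real number, with the principal value for a negative base:
   Log a = ln |a| + pi i, hence a^s = |a|^s (cos (pi s) + i sin (pi s)).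
   For a = 0 the value is that of powR, i.e. 0 if s <> 0 and 1 if s = 0. *)
Definition cpowR (R : realType) (a s : R) : complex R :=
  if 0 <= a then (a `^ s)%:C
  else (`|a| `^ s)%:C * (cos (pi * s) +i* sin (pi * s)).

Lemma cpowR_natr (R : realType) (a : R) (k : nat) :
  cpowR a k%:R = (a ^+ k)%:C.
Proof.
rewrite /cpowR; case: leP => a0; first by rewrite powR_mulrn.
have cosk : cos (pi * k%:R) = (-1) ^+ k :> R.
  elim: k => [|k IH]; first by rewrite mulr0 cos0.
  by rewrite -natr1 mulrDr mulr1 cosDpi IH exprS mulN1r.
have sink : sin (pi * k%:R) = 0 :> R.
  elim: k {cosk} => [|k IH]; first by rewrite mulr0 sin0.
  by rewrite -natr1 mulrDr mulr1 sinDpi IH oppr0.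
rewrite cosk sink powR_mulrn ?normr_ge0// ltr0_norm//.
by rewrite -[(-1) ^+ k +i* 0]/(((-1) ^+ k)%:C) -rmorphM -exprMn mulrN1 opprK.
Qed.

(* The values at t = 1 and t = -1 are conventional when alpha or beta is
   negative; there w(t) is only used multiplied by 1 - t^2 = 0 or under an
   integral sign. *)
Definition jacobi_weight (R : realType) (alpha beta t : R) : complex R :=
  cpowR (1 - t) alpha * cpowR (1 + t) beta.

Lemma jacobi_weight_real (R : realType) (alpha beta t : R) :
  -1 <= t <= 1 ->
  jacobi_weight alpha beta t = ((1 - t) `^ alpha * (1 + t) `^ beta)%:C.
Proof.
case/andP=> t1 t2; rewrite /jacobi_weight /cpowR subr_ge0 t2.
by rewrite -lerBlDl sub0r t1 rmorphM.
Qed.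

Definition cintegrable (R : realType) (D : set R) (f : R -> complex R) : Prop :=
  lebesgue_measure.-integrable D (fun t => (complex.Re (f t))%:E) /\
  lebesgue_measure.-integrable D (fun t => (complex.Im (f t))%:E).

Definition cintegral (R : realType) (D : set R) (f : R -> complex R) :
    complex R :=
  (\int[lebesgue_measure]_(t in D) complex.Re (f t))
  +i* (\int[lebesgue_measure]_(t in D) complex.Im (f t)).

(* Integral from a to b, with the usual sign change when b < a. *)
Definition interval_cintegrable (R : realType) (f : R -> complex R) (a b : R) :
    Prop :=
  cintegrable `[Num.min a b, Num.max a b] f.

Definition interval_cintegral (R : realType) (f : R -> complex R) (a b : R) :
    complex R :=
  if a <= b then cintegral `[a, b] f else - cintegral `[b, a] f.

(* Main.v *)
Require Import Defs.
From HB Require Import structures.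
From mathcomp Require Import all_boot all_order all_algebra.
From mathcomp Require Import complex.
From mathcomp Require Import all_classical all_reals all_analysis.
From mathcomp Require Import measurable_realfun ring lra.
Import Order.TTheory GRing.Theory Num.Theory.
Import numFieldNormedType.Exports.

(** The formula is the integrated form of the Sturm-Liouville identity for the
    Jacobi equation. Write phi for the augmented Wronskian, lambda_k for the
    eigenvalue k (k + alpha + beta + 1), and u (t) for the positive weight
    |1 - t|^alpha |1 + t|^beta. The differential equations of P_n and P_m
    ([jacobi_ode]) eliminate the second derivatives from phi', so that
      d/dt [u (t) (1 - t^2) phi (t)]
        = - (lambda_n - lambda_m) P_n (t) P_m (t) u (t)
    at every t other than 1 and -1 ([is_derive_boundary_term]). The function
    in brackets, the boundary term, is continuous on the whole line because
    alpha, beta > -1, and it vanishes at 1 and -1.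

    When an exponent is negative the integrand is unbounded near 1 or -1, and
    it changes sign, so that the fundamental theorem of calculus has to be
    extended to functions that are continuous on an open interval only
    ([dominated_FTC2]). For a nonnegative integrand this is monotone
    convergence; the signed case reduces to it as soon as the integrand is
    dominated by some g that has an antiderivative continuous up to the end
    points. Here g is a multiple of |1 - t|^alpha + |1 + t|^beta, because the
    two factors of u are never singular at the same point ([abs_weight_le]).

    The complex weight w differs from u by a phase that is constant on each of
    the three intervals cut out by -1 and 1. Hence the formula for u transfers
    to w on an interval that has neither of these points in its interior. If
    x < -1, the path is cut at -1, where the boundary term vanishes: the part
    over [-1, 1] then contributes 0, and the change of phase does no harm. *)

Set Implicit Arguments.
Unset Strict Implicit.
Unset Printing Implicit Defensive.

Local Open Scope classical_set_scope.
Local Open Scope ring_scope.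
Local Open Scope complex_scope.

Local Notation mu := (@lebesgue_measure _).

(** * The Jacobi differential equation *)

Lemma pochhammerS (R : pzRingType) (a : R) k :
  pochhammer a k.+1 = pochhammer a k * (a + k%:R).
Proof. by rewrite /pochhammer big_ord_recr. Qed.

Lemma pochhammer_gt0 (R : realFieldType) (a : R) k :
  0 < a -> 0 < pochhammer a k.
Proof. by move=> a0; apply: prodr_gt0 => i _; rewrite ltr_wpDr. Qed.

Lemma pochhammerN_eq0 (R : pzRingType) n k : (n < k)%N ->
  pochhammer (- n%:R : R) k = 0.
Proof.
elim: k => // k IH; rewrite ltnS leq_eqVlt pochhammerS => /predU1P[->|/IH ->].
  by rewrite addNr mulr0.
by rewrite mul0r.
Qed.

(** The coefficient of z^k in Gauss' hypergeometric series 2F1(a, b; c; z). *)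
Definition hyper_coef (R : fieldType) (a b c : R) (k : nat) : R :=
  pochhammer a k * pochhammer b k / (pochhammer c k * k`!%:R).

Lemma hyper_coefS (R : realFieldType) (a b c : R) k : 0 < c ->
  hyper_coef a b c k.+1 * (k%:R + 1) * (c + k%:R)
  = hyper_coef a b c k * (a + k%:R) * (b + k%:R).
Proof.
move=> c0; rewrite /hyper_coef !pochhammerS factS natrM -natr1.
have p0 := lt0r_neq0 (pochhammer_gt0 k c0).
have ck : c + k%:R != 0 by rewrite lt0r_neq0// ltr_wpDr.
have k1 : k%:R + 1 != 0 :> R by rewrite natr1 pnatr_eq0.
have f0 : (k`!)%:R != 0 :> R by rewrite pnatr_eq0 -lt0n fact_gt0.
by field; rewrite p0 ck k1 f0.
Qed.

(** The series 2F1(-n, b; c; z), which terminates at degree n. *)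
Definition hyper_poly (R : fieldType) (n : nat) (b c : R) : {poly R} :=
  \poly_(k < n.+1) hyper_coef (- n%:R) b c k.

(** The truncation at degree n is invisible, since (-n)_k = 0 for k > n: the
    two-term recurrence of [hyper_coefS] holds at the top degree as well. *)
Lemma coef_hyper_poly (R : fieldType) n (b c : R) k :
  (hyper_poly n b c)`_k = hyper_coef (- n%:R) b c k.
Proof.
rewrite coef_poly ltnS; case: leqP => // nk.
by rewrite /hyper_coef pochhammerN_eq0// !mul0r.
Qed.

(** Gauss' equation: the coefficient of z^k on the left is the recurrence of
    [hyper_coefS], as k^2 + (b - n) k - n b = (k - n) (k + b). *)
Lemma hyper_poly_ode (R : realFieldType) n (b c : R) : 0 < c ->
  let q := hyper_poly n b c in
  'X * (1 - 'X) * q^`()^`() + (c%:P - (1 - n%:R + b) *: 'X) * q^`()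
  + (n%:R * b) *: q = 0.
Proof.
move=> c0 q; apply/polyP => k.
rewrite [_ * q^`()]mulrBl.
rewrite [_ * q^`()^`()](_ : _ = 'X * q^`()^`() - 'X * ('X * q^`()^`()));
  last by ring.
rewrite -scalerAl !coefD !coefN !coefZ coefCM !coefXM coef0.
(* Multiplication by 'X, applied up to twice, shifts the coefficients, so that
   degrees 0 and 1 are separate from the others; each case is the recurrence. *)
case: k => [|[|k]]; rewrite /= ?coefXM /= !coef_deriv !coef_hyper_poly.
- have := @hyper_coefS _ (- n%:R) b c 0 c0.
  set x := hyper_coef _ _ _ 0; set y := hyper_coef _ _ _ 1 => H.
  by rewrite -[RHS](subrr (y * (0%:R + 1) * (c + 0%:R))) {2}H; ring.
- have := @hyper_coefS _ (- n%:R) b c 1 c0.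
  set x := hyper_coef _ _ _ 1; set y := hyper_coef _ _ _ 2 => H.
  by rewrite -[RHS](subrr (y * (1%:R + 1) * (c + 1%:R))) {2}H; ring.
- have := @hyper_coefS _ (- n%:R) b c k.+2 c0.
  set x := hyper_coef _ _ _ k.+2; set y := hyper_coef _ _ _ k.+3 => H.
  rewrite -[RHS](subrr (y * (k.+2%:R + 1) * (c + k.+2%:R))) {2}H.
  by rewrite -!natr1; ring.
Qed.

Lemma jacobi_hyper_poly (R : fieldType) (alpha beta : R) n :
  jacobi alpha beta n = (pochhammer (alpha + 1) n / n`!%:R) *:
    (hyper_poly n (alpha + beta + n%:R + 1) (alpha + 1) \Po (2^-1 *: (1 - 'X))).
Proof.
rewrite /jacobi /hyper_poly poly_def; congr (_ *: _); rewrite [RHS]raddf_sum.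
by apply: eq_bigr => k _; rewrite /= linearZ/= rmorphXn /= comp_polyX.
Qed.

(** This is Gauss' equation after the substitution z = (1 - x) / 2, under which
    1 - x^2 = 4 z (1 - z) and d/dx = - (1/2) d/dz. *)
Lemma jacobi_ode (R : realFieldType) (alpha beta : R) n (x : R) :
  -1 < alpha ->
  let P := jacobi alpha beta n in
  (1 - x ^+ 2) * P^`()^`().[x]
  + (beta - alpha - (alpha + beta + 2) * x) * P^`().[x]
  + n%:R * (n%:R + alpha + beta + 1) * P.[x] = 0.
Proof.
move=> ha P; rewrite /P jacobi_hyper_poly.
set q := hyper_poly _ _ _; move: (_ / _) => K.
pose z : {poly R} := 2^-1 *: (1 - 'X); rewrite -/z.
have c0 : 0 < alpha + 1 by rewrite -ltrBlDr sub0r.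
have dz : z^`() = - (2^-1)%:P.
  by rewrite /z derivZ derivB derivX derivC sub0r scalerN alg_polyC.
have zx : z.[x] = 2^-1 * (1 - x) by rewrite /z !hornerE.
have := congr1 (fun p => p.[z.[x]])
  (hyper_poly_ode n (alpha + beta + n%:R + 1) c0).
rewrite !derivZ !deriv_comp !derivM !deriv_comp dz derivN derivC.
rewrite oppr0 mulr0 addr0.
rewrite -/q !hornerE /= !horner_comp zx.
set q0 := q.[_]; set q1 := _.[_]; set q2 := _.[_] => H.
rewrite -[RHS](mulr0 K) -[X in _ = _ * X]H.
by field.
Qed.

(** * The fundamental theorem of calculus on an open interval *)

(** The denominators start at 3 so that every interval of the family is
    nondegenerate, as the fundamental theorem of calculus demands. *)
Lemma itv_open_closed_bigcup (R : realType) (a b : R) : a < b ->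
  `]a, b[%classic =
  \bigcup_n `[a + (b - a) / n.+3%:R, b - (b - a) / n.+3%:R]%classic.
Proof.
move=> ab; have ba : 0 < b - a by rewrite subr_gt0.
apply/seteqP; split=> [x|x [n _]] /=; rewrite !in_itv/=.
  move=> /andP[ax xb].
  have d0 : 0 < Num.min (x - a) (b - x) by rewrite lt_min !subr_gt0 ax.
  have [n nP] : exists n : nat, (b - a) / Num.min (x - a) (b - x) <= n%:R.
    exists (Num.truncn ((b - a) / Num.min (x - a) (b - x))).+1.
    by rewrite ltW// truncnS_gt.
  exists n => //=; rewrite in_itv/=.
  have : (b - a) / n.+3%:R <= Num.min (x - a) (b - x).
    rewrite ler_pdivrMr// mulrC -ler_pdivrMr// (le_trans nP)// ler_nat.
    by rewrite -addn3 leq_addr.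
  rewrite le_min; move: (_ / n.+3%:R) => e.
  by move=> /andP[h1 h2]; apply/andP; split; lra.
have : 0 < (b - a) / n.+3%:R by rewrite divr_gt0.
move: (_ / n.+3%:R) => e h /andP[h1 h2].
by apply/andP; split; lra.
Qed.

Lemma integrable_itvoo_itvcc (R : realType) (a b : R) (f : R -> R) :
  mu.-integrable `]a, b[ (EFin \o f) -> mu.-integrable `[a, b] (EFin \o f).
Proof.
move=> /integrableP[mf fi]; apply/integrableP; split.
  exact: emeasurable_fun_itv_cc mf.
by rewrite integral_itv_bndoo//; exact: measurableT_comp.
Qed.

Section improper_FTC2.
Variables (R : realType) (a b : R).
Hypothesis ab : a < b.

Lemma continuous_oo_measurable (f : R -> R) :
  {in `]a, b[, continuous f} -> measurable_fun `]a, b[ f.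
Proof.
move=> cf; apply: open_continuous_measurable_fun => // x.
by rewrite inE/=; exact: cf.
Qed.

(** Monotone convergence along an exhaustion by compact intervals, on each of
    which the classical theorem applies; continuity of F at a and b gives the
    limit. *)
Lemma ge0_integral_itvoo_FTC2 (f F : R -> R) :
  {in `]a, b[, forall x, 0 <= f x} ->
  {in `]a, b[, continuous f} -> {within `[a, b], continuous F} ->
  {in `]a, b[, forall x : R, is_derive x 1 F (f x)} ->
  (\int[mu]_(x in `]a, b[) (f x)%:E = (F b - F a)%:E)%E.
Proof.
move=> f0 cf cF dF.
pose d n : R := (b - a) / n.+3%:R.
have ba : 0 < b - a by rewrite subr_gt0.
have d0 n : 0 < d n by rewrite divr_gt0.
have d3 n : d n <= (b - a) / 3.
  by rewrite ler_pM2l// lef_pV2 ?posrE// ler_nat.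
have dnd n m : (n <= m)%N -> d m <= d n.
  by move=> nm; rewrite ler_pM2l// lef_pV2 ?posrE// ler_nat !ltnS.
pose A n := `[a + d n, b - d n]%classic.
have subA n x : a + d n <= x <= b - d n -> x \in `]a, b[%R.
  by have := d0 n => h /andP[? ?]; rewrite in_itv/=; apply/andP; split; lra.
have dcvg : d n @[n --> \oo] --> 0.
  rewrite /d -(mulr0 (b - a)); apply: cvgMr.
  rewrite [X in X @ _](_ : _ = [sequence harmonic (n + 2)%N]_n).
    by rewrite cvg_shiftn; exact: cvg_harmonic.
  by apply/funext => n; rewrite /= addn2.
have [ciF aF bF] := (continuous_within_itvP _ ab).1 cF.
have intA n : (\int[mu]_(x in A n) (f x)%:E = (F (b - d n) - F (a + d n))%:E)%E.
  have lt_n : a + d n < b - d n by have := d3 n; lra.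
  apply: continuous_FTC2 => //.
  - apply: continuous_in_subspaceT => x; rewrite inE /A/= in_itv/= => /subA.
    exact: cf.
  - have cFn : {within A n, continuous F}.
      apply: continuous_in_subspaceT => x; rewrite inE /A/= in_itv/= => /subA.
      exact: ciF.
    have [_ h1 h2] := (continuous_within_itvP _ lt_n).1 cFn.
    split => // x; rewrite in_itv/= => /andP[x1 x2].
    by apply: ex_derive; apply: dF; apply: (subA n); rewrite !ltW.
  - move=> x; rewrite in_itv/= => /andP[x1 x2].
    rewrite derive1E; apply: derive_val; apply: dF.
    by apply: (subA n); rewrite !ltW.
have cvg1 : (\int[mu]_(x in A n) (f x)%:E @[n --> \oo] -->
    \int[mu]_(x in `]a, b[) (f x)%:E)%E.
  rewrite (itv_open_closed_bigcup ab).
  have := @ge0_nondecreasing_set_cvg_integral _ (measurableTypeR R) R A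
    (EFin \o f) (@lebesgue_measure R).
  apply.
  - move=> n m nm; rewrite subsetEset; apply: subset_itv; rewrite bnd_simp.
      by rewrite lerD2l dnd.
    by rewrite lerD2l lerN2 dnd.
  - by move=> n; exact: measurable_itv.
  - move=> n; apply/measurable_EFinP.
    apply: measurable_funS (continuous_oo_measurable cf) => //.
    by move=> x /=; rewrite in_itv/= => /subA.
  - move=> n x; rewrite /A/= in_itv/= => /subA xab.
    by rewrite lee_fin f0.
have cvg2 : ((F (b - d n) - F (a + d n))%:E @[n --> \oo] --> (F b - F a)%:E)%E.
  apply: cvg_EFin; first exact: nearW.
  apply: cvgB.
  - apply: (cvg_at_leftP _ _ _).1 bF _ _; split.
      by move=> n; rewrite ltrBlDr ltrDl.
    by rewrite -[X in _ --> X]subr0; apply: cvgB => //; exact: cvg_cst.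
  - apply: (cvg_at_rightP _ _ _).1 aF _ _; split.
      by move=> n; rewrite ltrDl.
    by rewrite -[X in _ --> X]addr0; apply: cvgD => //; exact: cvg_cst.
move: cvg1.
rewrite (_ : (fun n => _) = (fun n => (F (b - d n) - F (a + d n))%:E)).
  by move=> /cvg_unique => /(_ _ _ cvg2); exact.
by apply/funext.
Qed.

Lemma ge0_integrable_itvoo_derive (f F : R -> R) :
  {in `]a, b[, forall x, 0 <= f x} ->
  {in `]a, b[, continuous f} -> {within `[a, b], continuous F} ->
  {in `]a, b[, forall x : R, is_derive x 1 F (f x)} ->
  mu.-integrable `]a, b[ (EFin \o f).
Proof.
move=> f0 cf cF dF; apply/integrableP; split.
  by apply/measurable_EFinP; exact: continuous_oo_measurable.
suff -> : (\int[mu]_(x in `]a, b[) `|(EFin \o f) x| = (F b - F a)%:E)%E.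
  by rewrite ltry.
rewrite -(ge0_integral_itvoo_FTC2 f0 cf cF dF); apply: eq_integral => x.
by rewrite inE/= => /f0 fx0; rewrite ger0_norm.
Qed.

(** As f + g and g are both nonnegative, the nonnegative case applies to each
    of them, and the formula for f follows by subtraction. *)
Lemma dominated_FTC2 (f F g G : R -> R) :
  {in `]a, b[, forall x, `|f x| <= g x} ->
  {in `]a, b[, continuous f} -> {within `[a, b], continuous F} ->
  {in `]a, b[, forall x : R, is_derive x 1 F (f x)} ->
  {in `]a, b[, continuous g} -> {within `[a, b], continuous G} ->
  {in `]a, b[, forall x : R, is_derive x 1 G (g x)} ->
  mu.-integrable `]a, b[ (EFin \o f) /\
  (\int[mu]_(x in `]a, b[) f x)%R = F b - F a.
Proof.
move=> fg cf cF dF cg cG dG.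
have g0 : {in `]a, b[, forall x, 0 <= g x}.
  by move=> x /fg; apply: le_trans.
have fg0 : {in `]a, b[, forall x, 0 <= f x + g x}.
  move=> x /fg; rewrite ler_norml => /andP[+ _].
  by rewrite -subr_ge0 opprK.
have cfg : {in `]a, b[, continuous (f \+ g)}.
  by move=> x xab; apply: continuousD; [exact: cf|exact: cg].
have cFG : {within `[a, b], continuous (F \+ G)}.
  by move=> x; apply: continuousD; [exact: cF|exact: cG].
have dFG : {in `]a, b[, forall x : R, is_derive x 1 (F \+ G) (f x + g x)}.
  by move=> x xab; apply: is_deriveD; [exact: dF|exact: dG].
have ig := ge0_integrable_itvoo_derive g0 cg cG dG.
have ifg := ge0_integrable_itvoo_derive fg0 cfg cFG dFG.
have Ig := ge0_integral_itvoo_FTC2 g0 cg cG dG.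
have Ifg := ge0_integral_itvoo_FTC2 fg0 cfg cFG dFG.
have fE : f = (fun x => (f \+ g) x - g x).
  by apply/funext => x /=; rewrite addrK.
split.
  rewrite fE; apply: eq_integrable (integrableB _ ifg ig) => //.
by rewrite fE RintegralB// /Rintegral Ig Ifg /=; ring.
Qed.

End improper_FTC2.

(** * The absolute weight *)

Lemma continuous_normr_powR (R : realType) (r t : R) : t != 0 ->
  {for t, continuous (fun s : R => `|s| `^ r)}.
Proof.
move=> t0.
have cabs : {for t, continuous (fun s : R => `|s|)} by exact: norm_continuous.
suff cpow : {for `|t|, continuous (fun s : R => s `^ r)}.
  exact: (continuous_comp cabs cpow).
apply/differentiable_continuous/derivable1_diffP.
by apply: derivable_powR; rewrite in_itv/= andbT normr_gt0.
Qed.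

(** The odd extension of t^(r + 1), which makes (r + 1) |t|^r a derivative on
    both sides of 0. *)
Definition odd_powR (R : realType) (r t : R) : R := t * `|t| `^ r.

Lemma is_derive_odd_powR (R : realType) (r t : R) : t != 0 ->
  is_derive t 1 (odd_powR r) ((r + 1) * `|t| `^ r).
Proof.
have pos (s : R) : 0 < s -> is_derive s 1 (odd_powR r) ((r + 1) * `|s| `^ r).
  move=> s0; apply: (@near_eq_is_derive R R R (fun z => z `^ (r + 1))).
  - near=> z; have z0 : 0 < z by near: z; exact: lt_nbhsr.
    rewrite /odd_powR gtr0_norm// addrC powRD ?powRr1 ?ltW//.
    by rewrite (gt_eqF z0) implybT.
  - rewrite gtr0_norm//; have := is_derive1_powR (r + 1) s0.
    by rewrite addrK.
have odd_odd : odd_powR r = (fun s => - odd_powR r (- s)).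
  by apply/funext => s; rewrite /odd_powR normrN mulNr opprK.
rewrite neq_lt => /orP[t0|]; last exact: pos.
rewrite odd_odd.
have nt0 : 0 < - t by rewrite oppr_gt0.
have := pos _ nt0; rewrite normrN => dN.
have -> : (r + 1) * `|t| `^ r = - ((r + 1) * `|t| `^ r * - 1).
  by rewrite mulrN1 opprK.
apply: is_deriveN; apply: (@is_derive1_comp _ (odd_powR r) -%R).
Unshelve. all: by end_near. Qed.

(** At 0 this holds because |odd_powR r t| = |t|^(r + 1) with r + 1 > 0. *)
Lemma continuous_odd_powR (R : realType) (r : R) : -1 < r ->
  continuous (odd_powR r).
Proof.
move=> r1 t; have [->|t0] := eqVneq t 0; last first.
  apply/differentiable_continuous/derivable1_diffP.
  by apply: ex_derive; exact: is_derive_odd_powR.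
have r10 : 0 < r + 1 by rewrite -ltrBlDr sub0r.
have normE s : `|odd_powR r s| = `|s| `^ (r + 1).
  rewrite /odd_powR normrM (ger0_norm (powR_ge0 _ _)) addrC powRD ?powRr1//.
  by rewrite addrC (gt_eqF r10).
suff : odd_powR r s @[s --> (0 : R)] --> (0 : R).
  by rewrite /continuous_at {3}/odd_powR mul0r.
apply/cvgr0Pnorm_lt => e e0; near=> s.
rewrite normE.
have -> : e = (e `^ (r + 1)^-1) `^ (r + 1).
  by rewrite -powRrM mulVf ?powRr1 ?ltW// gt_eqF.
apply: gt0_ltr_powR => //; rewrite ?nnegrE ?normr_ge0 ?powR_ge0//.
near: s.
have e1 : 0 < e `^ (r + 1)^-1 by exact: powR_gt0.
exact: (@nbhs0_lt R R _ e1).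
Unshelve. all: by end_near. Qed.

Section real_weight.
Variables (R : realType) (alpha beta : R).
Hypotheses (halpha : -1 < alpha) (hbeta : -1 < beta).

Definition abs_weight (t : R) : R := `|1 - t| `^ alpha * `|1 + t| `^ beta.

(** This form of (1 - t^2) |1 - t|^alpha |1 + t|^beta distributes one power of
    1 - t and of 1 + t to each factor, which makes continuity at 1 and -1
    evident. *)
Definition boundary_weight (t : R) : R :=
  odd_powR alpha (1 - t) * odd_powR beta (1 + t).

Lemma boundary_weightE t : boundary_weight t = abs_weight t * (1 - t ^+ 2).
Proof. by rewrite /boundary_weight /odd_powR /abs_weight; ring. Qed.

Lemma is_derive_1sub (t : R) : is_derive t 1 (fun s : R => 1 - s) (- 1).
Proof.
have := is_deriveB (is_derive_cst (1 : R) t 1) (is_derive_id t 1).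
by rewrite sub0r.
Qed.

Lemma is_derive_1add (t : R) : is_derive t 1 (fun s : R => 1 + s) 1.
Proof.
have := is_deriveD (is_derive_cst (1 : R) t 1) (is_derive_id t 1).
by rewrite add0r.
Qed.

Lemma continuous_1sub (t : R) : {for t, continuous (fun s : R => 1 - s)}.
Proof. by apply: continuousB; [exact: cvg_cst|exact: cvg_id]. Qed.

Lemma continuous_1add (t : R) : {for t, continuous (fun s : R => 1 + s)}.
Proof. by apply: continuousD; [exact: cvg_cst|exact: cvg_id]. Qed.

Lemma is_derive_odd_powR_1sub (r t : R) : t != 1 ->
  is_derive t 1 (fun s : R => odd_powR r (1 - s)) (- ((r + 1) * `|1 - t| `^ r)).
Proof.
move=> t1; rewrite -mulrN1.
apply: (@is_derive1_comp _ (odd_powR r) (fun s => 1 - s)).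
  by apply: is_derive_odd_powR; rewrite subr_eq0 eq_sym.
exact: is_derive_1sub.
Qed.

Lemma is_derive_odd_powR_1add (r t : R) : t != -1 ->
  is_derive t 1 (fun s : R => odd_powR r (1 + s)) ((r + 1) * `|1 + t| `^ r).
Proof.
move=> t1; rewrite -[X in is_derive _ _ _ X]mulr1.
apply: (@is_derive1_comp _ (odd_powR r) (fun s => 1 + s)).
  by apply: is_derive_odd_powR; rewrite addrC addr_eq0.
exact: is_derive_1add.
Qed.

Lemma continuous_odd_powR_1sub :
  continuous (fun t : R => odd_powR alpha (1 - t)).
Proof.
move=> t; apply: (continuous_comp (@continuous_1sub t)).
exact: continuous_odd_powR.
Qed.

Lemma continuous_odd_powR_1add :
  continuous (fun t : R => odd_powR beta (1 + t)).
Proof.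
move=> t; apply: (continuous_comp (@continuous_1add t)).
exact: continuous_odd_powR.
Qed.

Lemma continuous_boundary_weight : continuous boundary_weight.
Proof.
move=> t.
exact: (continuousM (@continuous_odd_powR_1sub t)
  (@continuous_odd_powR_1add t)).
Qed.

Lemma is_derive_boundary_weight (t : R) : t != 1 -> t != -1 ->
  is_derive t 1 boundary_weight
    (abs_weight t * (beta - alpha - (alpha + beta + 2) * t)).
Proof.
move=> t1 tN1.
have dM := is_deriveM (is_derive_odd_powR_1sub alpha t1)
  (is_derive_odd_powR_1add beta tN1).
apply: (@is_derive_eq _ _ _ boundary_weight _ _ _ _ dM).
rewrite /odd_powR /abs_weight /GRing.scale/=; ring.
Qed.

Lemma continuous_normr_powR_1sub (t : R) : t != 1 ->
  {for t, continuous (fun t : R => `|1 - t| `^ alpha)}.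
Proof.
move=> t1; apply: (@continuous_comp _ _ _ _ (fun s : R => `|s| `^ alpha) _
  (@continuous_1sub t)).
by apply: continuous_normr_powR; rewrite subr_eq0 eq_sym.
Qed.

Lemma continuous_normr_powR_1add (t : R) : t != -1 ->
  {for t, continuous (fun t : R => `|1 + t| `^ beta)}.
Proof.
move=> t1; apply: (@continuous_comp _ _ _ _ (fun s : R => `|s| `^ beta) _
  (@continuous_1add t)).
by apply: continuous_normr_powR; rewrite addrC addr_eq0.
Qed.

Lemma powR_le_powR_norm (L y r : R) : 1 <= y -> y <= L -> y `^ r <= L `^ `|r|.
Proof.
move=> y1 yL; apply: (@le_trans _ _ (y `^ `|r|)).
  by apply: ler_powR => //; exact: ler_norm.
apply: ge0_ler_powR => //; rewrite nnegrE; lra.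
Qed.

(** One of |1 - t| and |1 + t| is at least 1, and the corresponding power is
    then bounded in terms of the upper bound L, whatever the sign of the
    exponent; the other factor is kept. *)
Lemma abs_weight_le (L t : R) : `|1 - t| <= L -> `|1 + t| <= L ->
  abs_weight t <=
    (L `^ `|alpha| + L `^ `|beta|) * (`|1 - t| `^ alpha + `|1 + t| `^ beta).
Proof.
move=> L1 L2.
have := powR_ge0 L `|alpha|; have := powR_ge0 L `|beta|.
have := powR_ge0 `|1 - t| alpha; have := powR_ge0 `|1 + t| beta.
rewrite /abs_weight; move=> p2 p1 q2 q1.
have [t0|t0] := leP 0 t.
  have : `|1 + t| `^ beta <= L `^ `|beta|.
    by apply: powR_le_powR_norm => //; rewrite ger0_norm; lra.
  move: p1 p2 q1 q2; move: (_ `^ _) => A; move: (_ `^ _) => B.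
  by move: (_ `^ _) => C; move: (_ `^ _) => D; nra.
have : `|1 - t| `^ alpha <= L `^ `|alpha|.
  by apply: powR_le_powR_norm => //; rewrite ger0_norm; lra.
move: p1 p2 q1 q2; move: (_ `^ _) => A; move: (_ `^ _) => B.
by move: (_ `^ _) => C; move: (_ `^ _) => D; nra.
Qed.

End real_weight.

(** * The Sturm-Liouville identity *)

Definition jacobi_eigenvalue (R : pzRingType) (alpha beta : R) (n : nat) : R :=
  n%:R * (n%:R + alpha + beta + 1).

(** The difference of eigenvalues factors as (n - m) (n + m + alpha + beta + 1),
    and n + m >= 1 compensates for alpha + beta > -2. *)
Lemma subr_jacobi_eigenvalue_neq0 (R : realFieldType) (alpha beta : R) n m :
  -1 < alpha -> -1 < beta -> n <> m ->
  jacobi_eigenvalue alpha beta n - jacobi_eigenvalue alpha beta m != 0.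
Proof.
move=> ha hb nm.
have -> : jacobi_eigenvalue alpha beta n - jacobi_eigenvalue alpha beta m =
    (n%:R - m%:R) * (n%:R + m%:R + alpha + beta + 1).
  by rewrite /jacobi_eigenvalue; ring.
rewrite mulf_neq0// ?subr_eq0 ?eqr_nat; first exact/eqP.
have : (1 : R) <= n%:R + m%:R.
  rewrite -natrD ler1n lt0n addn_eq0; apply/negP => /andP[/eqP n0 /eqP m0].
  by apply: nm; rewrite n0 m0.
by move=> ?; rewrite gt_eqF//; lra.
Qed.

(** The products of first derivatives cancel in phi', and the difference of P_m
    times the equation of P_n and P_n times that of P_m is linear in phi', phi
    and P_n P_m. *)
Lemma augmented_wronskian_ode (R : realFieldType) (alpha beta : R) n m (x : R) :
  -1 < alpha ->
  let phi := augmented_wronskian alpha beta n m in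
  (1 - x ^+ 2) * phi^`().[x] + (beta - alpha - (alpha + beta + 2) * x) * phi.[x]
  = (jacobi_eigenvalue alpha beta m - jacobi_eigenvalue alpha beta n)
    * ((jacobi alpha beta n).[x] * (jacobi alpha beta m).[x]).
Proof.
move=> ha phi; rewrite /phi augmented_wronskianE.
have := jacobi_ode beta n x ha; have := jacobi_ode beta m x ha.
rewrite /= -/(jacobi_eigenvalue _ _ _) -/(jacobi_eigenvalue _ _ _).
move: (jacobi _ _ n) (jacobi _ _ m) => p q.
set c := beta - alpha - _.
move=> /eqP; rewrite addr_eq0 => /eqP Hq /eqP; rewrite addr_eq0 => /eqP Hp.
rewrite derivB !derivM !(hornerD, hornerN, hornerM).
transitivity (q.[x] * ((1 - x ^+ 2) * p^`()^`().[x] + c * p^`().[x])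
    - p.[x] * ((1 - x ^+ 2) * q^`()^`().[x] + c * q^`().[x])); first by ring.
by rewrite Hp Hq; ring.
Qed.

Definition boundary_term (R : realType) (alpha beta : R) (n m : nat) (t : R) :
    R :=
  boundary_weight alpha beta t * (augmented_wronskian alpha beta n m).[t].

Section real_integral.
Variables (R : realType) (alpha beta : R) (n m : nat).
Hypotheses (halpha : -1 < alpha) (hbeta : -1 < beta) (nm : n <> m).

Local Notation Q := (jacobi alpha beta n * jacobi alpha beta m).
Local Notation phi := (augmented_wronskian alpha beta n m).
Local Notation lambda :=
  (jacobi_eigenvalue alpha beta n - jacobi_eigenvalue alpha beta m).
Local Notation H := (boundary_term alpha beta n m).

Lemma is_derive_boundary_term (t : R) : t != 1 -> t != -1 ->
  is_derive t 1 H (- lambda * (Q.[t] * abs_weight alpha beta t)).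
Proof.
move=> t1 tN1.
have dM := is_deriveM (is_derive_boundary_weight alpha beta t1 tN1)
  (is_derive_poly phi t).
apply: (@is_derive_eq _ _ _ H _ _ _ _ dM).
have := augmented_wronskian_ode beta n m t halpha.
rewrite /= boundary_weightE hornerM opprB => E.
transitivity (abs_weight alpha beta t *
  ((jacobi_eigenvalue alpha beta m - jacobi_eigenvalue alpha beta n) *
    ((jacobi alpha beta n).[t] * (jacobi alpha beta m).[t]))); last by ring.
by rewrite -E /GRing.scale/=; ring.
Qed.

(** As the dominating function allows for both singularities at once, a single
    argument serves the intervals to the left of -1, inside [-1, 1], and to the
    right of 1. *)
Lemma jacobi_integral_itvoo (a b : R) : a <= b ->
  {in `]a, b[, forall t : R, t != 1 /\ t != -1} ->
  let f t := Q.[t] * abs_weight alpha beta t in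
  mu.-integrable `]a, b[ (EFin \o f) /\
  (\int[mu]_(t in `]a, b[) f t)%R = (H a - H b) / lambda.
Proof.
rewrite le_eqVlt => /predU1P[<- _ f|ab sing f].
  rewrite set_itvoo0 Rintegral_set0 subrr mul0r; split => //.
  exact: integrable_set0.
have lambda0 : lambda != 0 by exact: subr_jacobi_eigenvalue_neq0.
have a10 : alpha + 1 != 0 by rewrite gt_eqF// -ltrBlDr sub0r.
have b10 : beta + 1 != 0 by rewrite gt_eqF// -ltrBlDr sub0r.
have [M QM] : exists M, {in `[a, b], forall t, `|Q.[t]| <= M}.
  have [] := @EVT_max R (fun t => `|Q.[t]|) a b (ltW ab).
    apply: continuous_subspaceT => t.
    exact: (continuous_comp (@continuous_horner _ Q t)
      (@norm_continuous _ _ _)).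
  by move=> c _ Qc; exists `|Q.[c]| => t /Qc.
(* K g0 with g0 = |1 - t|^alpha + |1 + t|^beta dominates the integrand: M bounds
   the polynomial factor, L bounds |1 - t| and |1 + t| on [a, b]. *)
pose L := 1 + `|a| + `|b|.
pose K := M * (L `^ `|alpha| + L `^ `|beta|).
pose g t := K * (`|1 - t| `^ alpha + `|1 + t| `^ beta).
pose G := K \*: ((beta + 1)^-1 \*: (fun t : R => odd_powR beta (1 + t))
   - (alpha + 1)^-1 \*: (fun t : R => odd_powR alpha (1 - t))).
have cu (t : R) : t \in `]a, b[ ->
  {for t, continuous (fun t : R => `|1 - t| `^ alpha)}
  /\ {for t, continuous (fun t : R => `|1 + t| `^ beta)}.
  move=> /sing[t1 tN1]; split.
    exact: continuous_normr_powR_1sub.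
  exact: continuous_normr_powR_1add.
have fE : (- lambda^-1) *: (H b - H a) = (H a - H b) / lambda.
  by rewrite /GRing.scale/=; ring.
(* The antiderivative - H / lambda of the integrand is paired with G. *)
have [|||||||fi fI] := @dominated_FTC2 R a b ab f ((- lambda^-1) \*: H) g G.
- move=> t tab.
  have tab' : t \in `[a, b] by exact: subset_itv_oo_cc.
  have u0 : 0 <= abs_weight alpha beta t by rewrite mulr_ge0 ?powR_ge0.
  rewrite /f normrM (ger0_norm u0) /g /K -mulrA.
  have t_le : `|t| <= `|a| + `|b|.
    move: tab; rewrite in_itv/= => /andP[ta tb].
    have := ler_norm b; have := ler_norm (- a); rewrite normrN.
    have := normr_ge0 a; have := normr_ge0 b.
    by move=> ? ? ? ?; rewrite ler_norml; apply/andP; split; lra.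
  rewrite ler_pM ?QM// abs_weight_le//.
    by rewrite (le_trans (ler_normB _ _))// normr1 /L -addrA lerD2l.
  by rewrite (le_trans (ler_normD _ _))// normr1 /L -addrA lerD2l.
- move=> t tab; have [c1 c2] := cu t tab.
  exact: (continuousM (@continuous_horner _ Q t) (continuousM c1 c2)).
- apply: continuous_subspaceT => t.
  exact: (continuousM (@cst_continuous _ _ (- lambda^-1) t)
    (continuousM (@continuous_boundary_weight _ _ _ halpha hbeta t)
      (@continuous_horner _ phi t))).
- move=> t /sing[t1 tN1].
  have dZ := is_deriveZ (- lambda^-1) (is_derive_boundary_term t1 tN1).
  apply: (@is_derive_eq _ _ _ _ _ _ _ _ dZ).
  by rewrite /f /GRing.scale/=; field.
- move=> t tab; have [c1 c2] := cu t tab.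
  exact: (continuousM (@cst_continuous _ _ K t) (continuousD c1 c2)).
- apply: continuous_subspaceT => t.
  exact: (continuousM (@cst_continuous _ _ K t) (continuousB
    (continuousM (@cst_continuous _ _ (beta + 1)^-1 t)
      (@continuous_odd_powR_1add _ _ hbeta t))
    (continuousM (@cst_continuous _ _ (alpha + 1)^-1 t)
      (@continuous_odd_powR_1sub _ _ halpha t)))).
- move=> t /sing[t1 tN1].
  have dG := is_deriveZ K (is_deriveB
    (is_deriveZ (beta + 1)^-1 (is_derive_odd_powR_1add beta tN1))
    (is_deriveZ (alpha + 1)^-1 (is_derive_odd_powR_1sub alpha t1))).
  apply: (@is_derive_eq _ _ _ _ _ _ _ _ dG).
  by rewrite /g /GRing.scale/=; field; rewrite a10 b10.
by split => //; rewrite fI -fE scalerBr.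
Qed.

End real_integral.

(** * Complex integrals and the phase of the weight *)

Lemma integrable_setU d (T : measurableType d) (R : realType)
    (nu : {measure set T -> \bar R}) (A B : set T) (f : T -> \bar R) :
  measurable A -> measurable B -> [disjoint A & B] ->
  nu.-integrable A f -> nu.-integrable B f -> nu.-integrable (A `|` B) f.
Proof.
move=> mA mB AB /integrableP[mfA fA] /integrableP[mfB fB].
have mf : measurable_fun (A `|` B) f by exact/measurable_funU.
apply/integrableP; split => //.
rewrite ge0_integral_setU//; first exact: lte_add_pinfty.
exact: measurableT_comp.
Qed.

Section complex_phase.
Variable R : realType.

(** The factor by which the principal value of a^s differs from |a|^s. *)
Definition powR_phase (a s : R) : R[i] :=
  if 0 <= a then 1 else cos (pi * s) +i* sin (pi * s).

Lemma cpowR_phaseE (a s : R) : cpowR a s = powR_phase a s * (`|a| `^ s)%:C.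
Proof.
rewrite /cpowR /powR_phase; case: ifPn => [a0|_]; last by rewrite mulrC.
by rewrite mul1r ger0_norm.
Qed.

Definition weight_phase (alpha beta t : R) : R[i] :=
  powR_phase (1 - t) alpha * powR_phase (1 + t) beta.

Lemma jacobi_weight_phaseE (alpha beta t : R) :
  jacobi_weight alpha beta t =
  weight_phase alpha beta t * (abs_weight alpha beta t)%:C.
Proof.
by rewrite /jacobi_weight !cpowR_phaseE /weight_phase rmorphM /= mulrACA.
Qed.

(** The equation f = kappa h is asked for on the open interval only, because the
    phase of the weight jumps at 1 and -1; end points have measure zero. *)
Lemma cintegral_itv_phase (a b : R) (kappa : R[i]) (f : R -> R[i])
    (h : R -> R) :
  mu.-integrable `]a, b[ (EFin \o h) ->
  {in `]a, b[, forall t, f t = kappa * (h t)%:C} ->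
  cintegrable `[a, b] f /\
  cintegral `[a, b] f = kappa * (\int[mu]_(t in `]a, b[) h t)%R%:C.
Proof.
case: kappa => p q ih fE.
have part (k : R) (g : R -> R) : {in `]a, b[, forall t, g t = k * h t} ->
    mu.-integrable `[a, b] (fun t => (g t)%:E) /\
    (\int[mu]_(t in `[a, b]) g t)%R = k * (\int[mu]_(t in `]a, b[) h t)%R.
  move=> gE; have ig : mu.-integrable `]a, b[ (EFin \o g).
    apply: eq_integrable (integrableZl _ k ih) => // t; rewrite inE/= => tab.
    by rewrite gE.
  split; first exact: integrable_itvoo_itvcc.
  rewrite -RintegralZl// /Rintegral integral_itv_bndoo;
    last exact: measurable_int ig.
  congr fine; apply: eq_integral => t; rewrite inE/= => tab.
  by rewrite gE.
have [|iRe IRe] := part p (fun t => complex.Re (f t)).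
  by move=> t tab; rewrite fE//= mulr0 subr0.
have [|iIm IIm] := part q (fun t => complex.Im (f t)).
  by move=> t tab; rewrite fE//= mulr0 add0r.
split; first by split.
rewrite /cintegral IRe IIm; apply/eqP.
by rewrite eq_complex/= !mulr0 subr0 add0r !eqxx.
Qed.

Lemma cintegral_itv_split (a b c : R) (f : R -> R[i]) : a <= b -> b <= c ->
  cintegrable `[a, b] f -> cintegrable `[b, c] f ->
  cintegrable `[a, c] f /\
  cintegral `[a, c] f = cintegral `[a, b] f + cintegral `[b, c] f.
Proof.
move=> ab bc.
have part (g : R -> R) : mu.-integrable `[a, b] (EFin \o g) ->
    mu.-integrable `[b, c] (EFin \o g) ->
    mu.-integrable `[a, c] (EFin \o g) /\
    (\int[mu]_(t in `[a, c]) g t)%R =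
      (\int[mu]_(t in `[a, b]) g t + \int[mu]_(t in `[b, c]) g t)%R.
  move=> iab ibc.
  have ibc' : mu.-integrable `]b, c] (EFin \o g).
    by apply: integrableS ibc => //; apply: subset_itvr; rewrite bnd_simp.
  have acE : `[a, c]%classic = `[a, b]%classic `|` `]b, c]%classic.
    by rewrite -itv_bndbnd_setU// bnd_simp.
  have disj : [disjoint `[a, b]%classic & `]b, c]%classic].
    apply/disj_setPS => y [/=]; rewrite 2!in_itv/= => /andP[_ yb] /andP[].
    by rewrite ltNge yb.
  have iac : mu.-integrable `[a, c] (EFin \o g).
    by rewrite acE; exact: integrable_setU.
  split => //; rewrite acE Rintegral_setU//; last by rewrite -acE.
  by rewrite Rintegral_itv_obnd_cbnd.
move=> [r1 i1] [r2 i2].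
have [? Er] := part _ r1 r2; have [? Ei] := part _ i1 i2.
by split => //; rewrite /cintegral Er Ei.
Qed.

End complex_phase.

(** * The integral formula *)

Local Close Scope classical_set_scope.

Theorem theorem3p2 (R : realType) (alpha beta : R)
    (halpha : -1 < alpha) (hbeta : -1 < beta)
    (n m : nat) (hnm : n <> m) (x : R) :
  let P k := jacobi alpha beta k in
  let w := jacobi_weight alpha beta in
  let integrand t := (P n).[t]%:C * (P m).[t]%:C * w t in
  interval_cintegrable integrand x 1 /\
  interval_cintegral integrand x 1 =
    w x * (1 - x ^+ 2)%:C * (augmented_wronskian alpha beta n m).[x]%:C
    / (n%:R * (n%:R + alpha + beta + 1) - m%:R * (m%:R + alpha + beta + 1))%:C.
Proof.
move=> P w integrand.
rewrite -/(jacobi_eigenvalue _ _ n) -/(jacobi_eigenvalue _ _ m).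
pose lambda := jacobi_eigenvalue alpha beta n - jacobi_eigenvalue alpha beta m.
pose H := boundary_term alpha beta n m.
have piece (a b : R) (kappa : R[i]) : a <= b ->
    {in `]a, b[, forall t : R, t != 1 /\ t != -1} ->
    {in `]a, b[, forall t, weight_phase alpha beta t = kappa} ->
    cintegrable `[a, b] integrand /\
    cintegral `[a, b] integrand = kappa * ((H a - H b) / lambda)%:C.
  move=> ab sing phaseE.
  have [ih <-] := jacobi_integral_itvoo halpha hbeta hnm ab sing.
  apply: cintegral_itv_phase => // t tab.
  rewrite /integrand /w jacobi_weight_phaseE phaseE// hornerM !rmorphM /=.
  by rewrite mulrCA !mulrA.
have H1 : H 1 = 0.
  by rewrite /H /boundary_term boundary_weightE expr1n subrr mulr0 mul0r.
have N11 : -1 <= 1 :> R by rewrite (le_trans (lerN10 R)).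
have HN1 : H (-1) = 0.
  by rewrite /H /boundary_term boundary_weightE sqrrN expr1n subrr mulr0 mul0r.
have -> : w x * (1 - x ^+ 2)%:C * (augmented_wronskian alpha beta n m).[x]%:C
      / lambda%:C =
    weight_phase alpha beta x * (H x / lambda)%:C.
  rewrite /w jacobi_weight_phaseE /H /boundary_term boundary_weightE.
  by rewrite !rmorphM /= fmorphV !mulrA.
(* The phase depends on the sign of the base only: -1 represents all negative
   bases. *)
have phase_gt1 t : 1 < t -> weight_phase alpha beta t = powR_phase (-1) alpha.
  move=> t1; rewrite /weight_phase /powR_phase ifF; last first.
    by apply/negbTE; rewrite -ltNge subr_lt0.
  rewrite ifT; last by rewrite addr_ge0// (le_trans ler01)// ltW.
  by rewrite mulr1 ifF// ler0N1.
have phase_mid t : -1 <= t <= 1 -> weight_phase alpha beta t = 1.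
  move=> /andP[t1 t2]; rewrite /weight_phase /powR_phase !ifT ?mulr1 ?subr_ge0//.
  by rewrite -lerBlDl sub0r.
have phase_ltN1 t : t < -1 -> weight_phase alpha beta t = powR_phase (-1) beta.
  move=> t1; rewrite /weight_phase /powR_phase ifT; last first.
    by rewrite subr_ge0; lra.
  rewrite mul1r ifF; last by apply/negbTE; rewrite -ltNge; lra.
  by rewrite ifF// ler0N1.
rewrite /interval_cintegrable /interval_cintegral.
have [x1|x1] := leP x 1; last first.
  rewrite phase_gt1//.
  have [||iI ->] := piece 1 x (powR_phase (-1) alpha) (ltW x1).
  - move=> t; rewrite in_itv/= => /andP[t1 _]; split; rewrite gt_eqF//; lra.
  - by move=> t; rewrite in_itv/= => /andP[t1 _]; exact: phase_gt1.
  by split => //; rewrite H1 sub0r mulNr rmorphN mulrN opprK.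
have mid a : -1 <= a -> a <= 1 -> cintegrable `[a, 1] integrand /\
    cintegral `[a, 1] integrand = (H a / lambda)%:C.
  move=> aN1 a1; have [||iI ->] := piece a 1 1 a1.
  - move=> t; rewrite in_itv/= => /andP[t1 t2]; split.
      by rewrite lt_eqF.
    by rewrite gt_eqF// (le_lt_trans aN1).
  - move=> t; rewrite in_itv/= => /andP[t1 t2]; apply: phase_mid.
    by rewrite (le_trans aN1 (ltW t1)) ltW.
  by rewrite H1 subr0 mul1r.
(* Below -1 the integral from -1 to 1 vanishes, as both end values of H do. *)
have [xN1|xN1] := leP (-1) x.
  by rewrite phase_mid ?xN1// mul1r; exact: mid.
have [||iI II] := piece x (-1) (powR_phase (-1) beta) (ltW xN1).
- move=> t; rewrite in_itv/= => /andP[_ t1]; split; rewrite lt_eqF//; lra.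
- by move=> t; rewrite in_itv/= => /andP[_ t1]; exact: phase_ltN1.
have [iJ JJ] := mid (-1) (lexx _) N11.
have [iK ->] := cintegral_itv_split (ltW xN1) N11 iI iJ.
by split => //; rewrite II JJ HN1 subr0 mul0r addr0 phase_ltN1.
Qed.
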